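(* Let $\mathbb{P}$ be a partition, $P_0$ a probability on $\mathcal A(\mathbb P)$, $a\in\mathbb R$, $b>0$. If $\mu:\mathcal A(\mathbb P)\to\mathbb R$ is NL$(a,b)$ (with respect to $P_0$), then its conjugate $\mu^c$, defined by $\mu^c(A)=1-\mu(\neg A)$ for all $A\in\mathcal A(\mathbb P)$, is NL$(c,b)$ (with respect to the same $P_0$), where $c=1-(a+b)$.
   Context: A partition $\mathbb P$ is an arbitrary (finite or infinite) set of pairwise disjoint non-impossible events (atoms) whose logical sum is the sure event $\Omega$. $\mathcal A(\mathbb P)$ is the set of events logically dependent on $\mathbb P$, i.e. the powerset of $\mathbb P$ (events are identified with sets of atoms); $\emptyset$ is the impossible event and $\neg A$ is the complement of $A$. A probability on $\mathcal A(\mathbb P)$ is a finitely additive function $P_0:\mathcal A(\mathbb P)\to[0,1]$ with $P_0(\Omega)=1$ (no countable additivity is required). Given $P_0$, $a\in\mathbb R$ and $b>0$, a function $\mu:\mathcal A(\mathbb P)\to\mathbb R$ is NL$(a,b)$ (a Nearly-Linear imprecise probability) if $\mu(\emptyset)=0$, $\mu(\Omega)=1$, and for all $A\in\mathcal A(\mathbb P)\setminus\{\emptyset,\Omega\}$, $\mu(A)=\min\{\max\{bP_0(A)+a,0\},1\}$. *)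

(* Defs.v *)
From mathcomp Require Import all_boot all_order all_algebra.
From mathcomp Require Import classical_sets reals.

Set Implicit Arguments.
Unset Strict Implicit.
Unset Printing Implicit Defensive.

Import Order.TTheory GRing.Theory Num.Theory.

Local Open Scope classical_set_scope.
Local Open Scope ring_scope.

(* A partition is represented by the type [P] of its atoms. An event that is
   logically dependent on the partition is identified with the set of atoms
   whose logical sum it is: the family of these events is [set P], the
   impossible event is [set0] and the sure event is [setT]. *)

(* Finitely additive: no countable additivity is required. Additivity at
   [A = B = set0] gives [P0 set0 = 0], so no probability exists when [P] is
   empty. *)
Definition is_probability (R : realType) (P : Type) (P0 : set P -> R) : Prop :=
  [/\ forall A : set P, 0 <= P0 A <= 1,
      P0 setT = 1
    & forall A B : set P, A `&` B = set0 -> P0 (A `|` B) = P0 A + P0 B].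

Definition is_NL (R : realType) (P : Type) (P0 : set P -> R) (a b : R)
    (mu : set P -> R) : Prop :=
  [/\ mu set0 = 0,
      mu setT = 1
    & forall A : set P, A <> set0 -> A <> setT ->
        mu A = Num.min (Num.max (b * P0 A + a) 0) 1].

Definition conjugate (R : realType) (P : Type) (mu : set P -> R) : set P -> R :=
  fun A => 1 - mu (~` A).

(* Main.v *)
Require Import Defs.
From mathcomp Require Import all_boot all_order all_algebra.
From mathcomp Require Import classical_sets reals.
From mathcomp Require Import ring lra.

(** Since [P0 (~` A) = 1 - P0 A], complementing an event turns the value
    [b * P0 A + a] into [b + a - b * P0 A], and the outer [1 - _] of the
    conjugate turns that into [b * P0 A + (1 - (a + b))]. The truncation to
    [[0, 1]] does not interfere, because it commutes with the reflection
    [x |-> 1 - x], which maps the unit interval to itself and swaps the two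
    thresholds ([clamp01_onem]). *)

Import Order.TTheory GRing.Theory.

Local Open Scope ring_scope.

Lemma clamp01_onem (R : realDomainType) (x : R) :
  1 - Num.min (Num.max x 0) 1 = Num.min (Num.max (1 - x) 0) 1.
Proof.
case: (ltP x 0) => ?; case: (ltP (1 - x) 0) => ?; case: (ltP (0 : R) 1) => ?;
  case: (ltP x 1) => ?; case: (ltP (1 - x) 1) => ?; lra.
Qed.

Lemma probability_setC (R : realType) (P : Type) (P0 : set P -> R) (A : set P) :
  is_probability P0 -> P0 (~` A)%classic = 1 - P0 A.
Proof.
move=> [_ P0T P0U].
by have := P0U A (~` A)%classic (setICr A); rewrite setUv P0T; lra.
Qed.

Theorem proposition3p1 (R : realType) (P : Type) (P0 : set P -> R) (a b : R)
    (mu : set P -> R) :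
  is_probability P0 -> 0 < b ->
  is_NL P0 a b mu -> is_NL P0 (1 - (a + b)) b (conjugate mu).
Proof.
move=> P0prob _ [mu0 muT muE]; split; rewrite /conjugate.
- by rewrite setC0 muT subrr.
- by rewrite setCT mu0 subr0.
move=> A A0 AT.
rewrite muE; first last.
- by rewrite -setC0 => /setC_inj.
- by rewrite -setCT => /setC_inj.
rewrite clamp01_onem probability_setC//.
by congr (Num.min (Num.max _ 0) 1); ring.
Qed.
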